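(* Let $G$ be a connected graph and $v\in V(G)$. Let $G_v^t$ be the graph obtained from $G$ by adding a new vertex $v'$ such that $v$ and $v'$ are true twins. Then $$h(\mathcal{R}(G_v^t))\leq \frac{2|\mathcal{R}(G)|}{|\mathcal{R}(G_v^t)|}.$$
   Context: Graphs are finite, simple and undirected. Two vertices $u,v$ of a graph are true twins if $N[u]=N[v]$, where $N[v]=N(v)\cup\{v\}$ is the closed neighborhood; thus in $G_v^t$ the new vertex $v'$ is adjacent exactly to $v$ and to all neighbors of $v$ in $G$. A search tree $T$ on a connected graph $G$ is a rooted tree with vertex set $V(G)$, defined recursively: the root of $T$ is a chosen vertex $r\in V(G)$, and the children of $r$ are the roots of search trees on each of the connected components of $G-r$. Let $T$ be a search tree on $G$ and let $v$ be a child of $u$ in $T$. The $uv$-rotation transforms $T$ into the search tree $T'$ on $G$ such that: (i) $u$ is a child of $v$ in $T'$; if $u$ is the root of $T$ then $v$ is the root of $T'$, otherwise, if $p$ is the parent of $u$ in $T$, then $p$ is the parent of $v$ in $T'$; (ii) every subtree of $u$ in $T$ other than the one rooted at $v$ remains a subtree of $u$ in $T'$; (iii) each subtree $S$ of $v$ in $T$ becomes a subtree of $u$ in $T'$ if $u$ is adjacent in $G$ to some vertex of $S$, and otherwise remains a subtree of $v$. All other parent-child relations are unchanged. The rotation graph $\mathcal{R}(G)$ is the undirected graph whose vertices are the search trees on $G$, two search trees being adjacent if one is obtained from the other by a single rotation. $|\mathcal{R}(G)|$ denotes its number of vertices. The edge expansion of a graph $H$ is $h(H)=\min |\partial S|/|S|$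 over nonempty $S\subseteq V(H)$ with $|S|\leq |V(H)|/2$, where $\partial S$ is the set of edges with one endpoint in $S$ and the other in $V(H)\setminus S$. *)

(* Defs.v *)
From HB Require Import structures.
From mathcomp Require Import all_boot all_order all_algebra.

Set Implicit Arguments.
Unset Strict Implicit.
Unset Printing Implicit Defensive.

Import Order.TTheory GRing.Theory Num.Theory.

Record sgraph := SGraph {
  vertex :> finType;
  adj : rel vertex;
  adj_sym : symmetric adj;
  adj_irr : irreflexive adj
}.

Arguments SGraph [vertex adj].
Arguments adj {s} x y.

Definition connected (G : sgraph) : Prop := forall x y : G, connect adj x y.

Definition induced_adj (G : sgraph) (A : {set G}) : rel G :=
  [rel x y | [&& x \in A, y \in A & adj x y]].

(* The vertex sets of the connected components of the induced subgraph G[A]. *)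
Definition components (G : sgraph) (A : {set G}) : {set {set G}} :=
  [set [set y in A | connect (induced_adj A) x y] | x in A].

Section TrueTwins.

Variables (G : sgraph) (v : G).

Definition closed_neighborhood (x : G) : {set G} := [set y | (y == x) || adj x y].

Definition true_twins (x y : G) : Prop :=
  closed_neighborhood x = closed_neighborhood y.

(* [Some] embeds G, and [None] is the new vertex v'. *)
Definition twin_adj : rel (option G) := fun x y =>
  match x, y with
  | Some x', Some y' => adj x' y'
  | Some x', None | None, Some x' => x' \in closed_neighborhood v
  | None, None => false
  end.

Lemma twin_adj_sym : symmetric twin_adj.
Proof. by move=> [x|] [y|] //=; rewrite adj_sym. Qed.

Lemma twin_adj_irr : irreflexive twin_adj.
Proof. by move=> [x|] //=; rewrite adj_irr. Qed.

Definition add_true_twin : sgraph := SGraph twin_adj_sym twin_adj_irr.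

End TrueTwins.

Lemma add_true_twinP (G : sgraph) (v : G) :
  @true_twins (add_true_twin v) (Some v) None.
Proof.
apply/setP => -[x|]; rewrite !inE /adj /= ?inE ?eqxx ?orbT //.
Qed.

Section SearchTrees.

Variable G : sgraph.

(* A rooted tree on V(G) is encoded by its parent function, which is [None]
   exactly at the root. *)
Implicit Types (T : {ffun G -> option G}) (A C : {set G}) (r u v w x y : G).

(* [n] is recursion fuel; [search_tree_onE] is the recursion without it. *)
Fixpoint search_tree_rec T n A r : bool :=
  if n is n'.+1 then
    (r \in A) &&
    [forall C in components (A :\ r),
       [exists c in C, (T c == Some r) && search_tree_rec T n' C c]]
  else false.

(* [T], restricted to [A], is a search tree on G[A] with root [r]; the parent
   of [r] itself is left unconstrained. *)
Definition search_tree_on T A r : bool := search_tree_rec T #|A| A r.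

Definition is_search_tree T : bool :=
  [exists r, (T r == None) && search_tree_on T [set: G] r].

Lemma component_sub A C : C \in components A -> C \subset A.
Proof.
by case/imsetP => x _ ->; apply/subsetP => y; rewrite inE => /andP[].
Qed.

Lemma mem_component A x :
  x \in A -> exists2 C, C \in components A & x \in C.
Proof.
move=> xA; exists [set y in A | connect (induced_adj A) x y].
  exact: imset_f.
by rewrite inE xA connect0.
Qed.

Lemma search_tree_rec_fuel T n A r :
  #|A| <= n -> search_tree_rec T n A r = search_tree_on T A r.
Proof.
rewrite /search_tree_on; move: {2 4}#|A| (leqnn #|A|) => m.
elim: n m A r => [|n IHn] [|m] A r //=.
- by move=> _; rewrite leqn0 => /eqP/cards0_eq ->; rewrite inE.
- by rewrite leqn0 => /eqP/cards0_eq -> _; rewrite inE.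
move=> lem len; case rA: (r \in A) => //=.
apply: eq_forallb => C; case CA: (C \in _) => //=.
apply: eq_existsb => c; rewrite (IHn m) //.
all: have := subset_leq_card (component_sub CA).
all: by move: lem len; rewrite (cardsD1 r A) rA !ltnS; move=> ? ? /leq_trans; apply.
Qed.

Lemma search_tree_onE T A r :
  search_tree_on T A r =
  (r \in A) &&
  [forall C in components (A :\ r),
     [exists c in C, (T c == Some r) && search_tree_on T C c]].
Proof.
rewrite -(@search_tree_rec_fuel T #|A|.+1) //=.
case rA: (r \in A) => //=.
apply: eq_forallb => C; case CA: (C \in _) => //=.
apply: eq_existsb => c; rewrite search_tree_rec_fuel //.
exact: leq_trans (subset_leq_card (component_sub CA)) (subset_leq_card (subsetDl _ _)).
Qed.

Lemma search_tree_on_parent T A r x :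
  search_tree_on T A r -> x \in A -> x != r -> T x != Some x.
Proof.
move: {2}#|A| (leqnn #|A|) => n; elim: n A r x => [|n IHn] A r x.
  by rewrite leqn0 => /eqP/cards0_eq -> _; rewrite inE.
move=> len; rewrite search_tree_onE => /andP[rA /forall_inP h] xA xr.
have /mem_component[C CA xC] : x \in A :\ r by rewrite !inE xr.
have /exists_inP[c cC /andP[/eqP Tc hc]] := h _ CA.
case: (eqVneq x c) => [->|xc].
  apply: contraTneq cC; rewrite Tc => -[<-].
  by apply/negP => /(subsetP (component_sub CA)); rewrite !inE eqxx.
apply: (IHn C c) => //.
have := subset_leq_card (component_sub CA).
by move: len; rewrite (cardsD1 r A) rA ltnS => len /leq_trans; apply.
Qed.

Lemma search_tree_parent T x : is_search_tree T -> T x != Some x.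
Proof.
case/existsP => r /andP[/eqP Tr h].
by case: (eqVneq x r) => [->|]; [rewrite Tr | apply: search_tree_on_parent h _].
Qed.

Definition subtree T w : {set G} :=
  [set x | connect [rel y z | T y == Some z] x w].

Definition rotation T u v : {ffun G -> option G} :=
  [ffun w =>
     if w == v then T u
     else if w == u then Some v
     else if T w == Some v then
       if [exists x in subtree T w, adj u x] then Some u else Some v
     else T w].

Definition rotates_to T T' : bool :=
  [exists u, [exists v, (T v == Some u) && (T' == rotation T u v)]].

Definition search_tree : finType :=
  {T : {ffun G -> option G} | is_search_tree T}.

Definition rotation_adj : rel search_tree := fun (T T' : search_tree) =>
  rotates_to (val T) (val T') || rotates_to (val T') (val T).

Lemma rotation_adj_sym : symmetric rotation_adj.
Proof. by move=> ? ?; rewrite /rotation_adj orbC. Qed.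

Lemma rotation_adj_irr : irreflexive rotation_adj.
Proof.
move=> [T hT]; rewrite /rotation_adj /= orbb; apply/negbTE/negP.
case/existsP => u /existsP[v /andP[/eqP Tv /eqP TT]].
have uv : u != v.
  by apply: contraTneq (search_tree_parent v hT) => uv; rewrite Tv uv eqxx.
have Tu : T u = Some v by rewrite TT ffunE (negbTE uv) eqxx.
have : T v = T u by rewrite {1}TT ffunE eqxx.
by rewrite Tv Tu => -[/eqP]; rewrite (negbTE uv).
Qed.

Definition rotation_graph : sgraph := SGraph rotation_adj_sym rotation_adj_irr.

End SearchTrees.

Section EdgeExpansion.

Local Open Scope ring_scope.

Variable H : sgraph.
Implicit Type S : {set H}.

Definition edge_boundary S : {set {set H}} :=
  [set [set x; y] | x in S, y in ~: S & adj x y].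

Definition expansion_set S : bool := (S != set0) && (2 * #|S| <= #|H|)%N.

Definition boundary_ratio S : rat := #|edge_boundary S|%:R / #|S|%:R.

(* The minimum is over a nonempty family as soon as H has two vertices; the
   value 0 for smaller H is arbitrary. *)
Definition edge_expansion : rat :=
  if [pick S | expansion_set S] is Some S0
  then boundary_ratio [arg min_(S < S0 | expansion_set S) boundary_ratio S]%O
  else 0.

Lemma edge_expansion_attained : (1 < #|H|)%N ->
  exists2 S, expansion_set S & edge_expansion = boundary_ratio S.
Proof.
move=> H2; rewrite /edge_expansion; case: pickP => [S0 hS0|h0].
  by case: arg_minP => // S hS _; exists S.
have /card_gt0P[x _] := ltnW H2.
by have := h0 [set x]; rewrite /expansion_set -cards_eq0 cards1 muln1 H2.
Qed.

Lemma edge_expansion_le S : expansion_set S -> edge_expansion <= boundary_ratio S.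
Proof.
move=> hS; rewrite /edge_expansion; case: pickP => [S0 hS0|/(_ S)].
  by case: arg_minP => // S1 _; apply.
by rewrite hS.
Qed.

End EdgeExpansion.

(* Main.v *)
Require Import Defs.
From mathcomp Require Import all_boot all_order all_algebra.

Set Implicit Arguments.
Unset Strict Implicit.
Unset Printing Implicit Defensive.

Import Order.TTheory GRing.Theory Num.Theory.

Local Open Scope ring_scope.

(** Write H for the graph G with a true twin v' of v added, and cut the search
    trees on H according to which of the two twins lies above the other; they
    are always comparable, being adjacent. Let S be the set of trees in which
    v is above v'. The bound is the boundary ratio of S.

    Exchanging the labels v and v' is an automorphism of H, so it acts on search
    trees and maps S onto its complement; hence S contains exactly half of them
    ([card_twin_side]).

    A rotation of the edge between w and its parent u reverses the order of no
    pair of vertices other than u and w ([rotation_reverse]). So along an edge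
    leaving S it is the edge between the twins that is rotated, and the end of
    it in S is a tree T in which v' is a child of v. As v and v' have the same
    closed neighborhood, v' is then the only child of v
    ([twin_only_child]), and the rotation does nothing but exchange the labels
    ([twin_rotation]); the other end is thus determined by T, and the boundary
    of S has at most as many edges as there are such trees
    ([card_boundary_twin_side]).

    Contracting v' into its parent v turns such a T into a search tree on G,
    from which T can be recovered, v' being the only child of v
    ([contract_spec], [contract_inj]). The boundary therefore has at most
    |R(G)| edges while S has |R(H)| / 2 vertices.

    All this is carried out on a description of search trees by their descendant
    order alone, without recursion ([is_search_treeP]): there is a root above
    every vertex, adjacent vertices are comparable, and below each child there
    is a neighbor of its parent. *)

(** * The descendant order of a parent function *)

Section Descendants.

Variables (G : sgraph) (T : {ffun G -> option G}).

Lemma subtree_refl x : x \in subtree T x.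
Proof. by rewrite inE connect0. Qed.

Lemma subtree_trans y x z :
  x \in subtree T y -> y \in subtree T z -> x \in subtree T z.
Proof. by rewrite !inE; apply: connect_trans. Qed.

Lemma subtree_parent x y : T x = Some y -> x \in subtree T y.
Proof. by move=> Txy; rewrite inE connect1 //= Txy. Qed.

Lemma subtree_ind y (P : G -> Prop) :
  P y -> (forall x z, T x = Some z -> z \in subtree T y -> P z -> P x) ->
  forall x, x \in subtree T y -> P x.
Proof.
move=> Py Pstep x; rewrite inE => /connectP[p].
elim: p x => [|z p IHp] x /= => [_ <- //|/andP[/eqP Txz pth] lst].
apply: Pstep Txz _ (IHp _ pth lst).
by rewrite inE; apply/connectP; exists p.
Qed.

Lemma subtree_up x y :
  x \in subtree T y -> x = y \/ exists2 z, T x = Some z & z \in subtree T y.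
Proof. by elim/subtree_ind: x / => [|x z Txz zy _]; [left | right; exists z]. Qed.

Lemma subtree_down x y :
  x \in subtree T y -> x = y \/ exists2 z, T z = Some y & x \in subtree T z.
Proof.
elim/subtree_ind: x / => [|x z Txz _ [<-|[c Tc zc]]]; first by left.
  by right; exists x; rewrite ?subtree_refl.
by right; exists c => //; apply: subtree_trans zc; apply: subtree_parent.
Qed.

Lemma subtree_total x y z :
  x \in subtree T y -> x \in subtree T z ->
  y \in subtree T z \/ z \in subtree T y.
Proof.
elim/subtree_ind: x / => [|x c Txc cy IH]; first by left.
move=> /subtree_up[<-|[d]]; last by rewrite Txc => -[<-].
by right; apply: subtree_trans cy; apply: subtree_parent.
Qed.

(** This also excludes cycles of the parent function: along a cycle the root
    would never be reached. *)
Definition rooted := exists2 r, T r = None & forall x, x \in subtree T r.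

Hypothesis rootedT : rooted.

Lemma subtree_anti x y : x \in subtree T y -> y \in subtree T x -> x = y.
Proof.
have [r Tr below] := rootedT; move: y.
elim/subtree_ind: x / (below x) => [y /subtree_up[//|[z]]|x z Txz _ IH y xy yx].
  by rewrite Tr.
case: (subtree_up xy) => [//|[c]]; rewrite Txz => -[<-] zy.
have yz : z = y by apply: IH => //; apply: subtree_trans yx (subtree_parent Txz).
by rewrite -yz in yx *; apply/esym/IH => //; apply: subtree_parent.
Qed.

Lemma parent_neq x : T x <> Some x.
Proof.
move=> Txx; have [r Tr /(_ x) xr] := rootedT.
suff xE : x = r by rewrite -xE Txx in Tr.
move: xr; rewrite inE => /connectP[p]; elim: p => //= z p IHp.
by rewrite Txx => /andP[/eqP[<-]]; apply: IHp.
Qed.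

Lemma parent_notin x y : T x = Some y -> y \notin subtree T x.
Proof.
move=> Txy; apply/negP => yx; apply: (@parent_neq x).
by rewrite {1}Txy (subtree_anti yx (subtree_parent Txy)).
Qed.

End Descendants.

(** * Search trees described without recursion *)

Section Characterization.

Variable G : sgraph.
Implicit Types (T : {ffun G -> option G}) (A C : {set G}).

(** The last condition is what makes every subtree connected in G; together with
    comparability of adjacent vertices, it makes the subtrees of the children of
    w the components of what remains of the subtree of w without w. *)
Definition tree_spec T :=
  [/\ rooted T,
      forall x y, adj x y -> x \in subtree T y \/ y \in subtree T x
    & forall x y, T x = Some y -> exists2 z, z \in subtree T x & adj y z].

Definition connected_in A :=
  forall x y, x \in A -> y \in A -> connect (induced_adj A) x y.

Lemma induced_adjE A x y :
  induced_adj A x y = [&& x \in A, y \in A & adj x y].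
Proof. by []. Qed.

Lemma induced_adj_sym A : symmetric (induced_adj A).
Proof. by move=> x y; rewrite !induced_adjE adj_sym andbCA. Qed.

Lemma connect_inducedC A : connect_sym (induced_adj A).
Proof. exact/sym_connect_sym/induced_adj_sym. Qed.

Lemma connect_inducedS A (B : {set G}) x y :
  A \subset B -> connect (induced_adj A) x y -> connect (induced_adj B) x y.
Proof.
move=> /subsetP AB; apply: connect_sub => u v /and3P[uA vA uv].
by apply: connect1; rewrite induced_adjE !AB.
Qed.

Lemma component_connected A C : C \in components A -> connected_in C.
Proof.
case/imsetP => x xA ->; set D := [set _ in _ | _].
suff xD y : y \in D -> connect (induced_adj D) x y.
  by move=> y z /xD yD /xD; apply: connect_trans; rewrite connect_inducedC.
rewrite inE => /andP[_ /connectP[p]].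
elim/last_ind: p y => [|p z IHp] y /=; first by move=> _ ->.
rewrite rcons_path last_rcons => /andP[pth /and3P[lA zA adjz]] ->.
apply: connect_trans (IHp _ pth erefl) (connect1 _).
have lD : connect (induced_adj A) x (last x p) by apply/connectP; exists p.
rewrite induced_adjE !inE lA lD zA adjz /= andbT.
by apply: connect_trans lD (connect1 _); rewrite induced_adjE lA zA.
Qed.

(** A path in A from a vertex of C to r leaves C only through r, so the vertex
    preceding the first visit of r is the one sought. *)
Lemma component_adj A C r :
  connected_in A -> r \in A -> C \in components (A :\ r) ->
  exists2 z, z \in C & adj r z.
Proof.
move=> connA rA /imsetP[x]; rewrite !inE => /andP[xr xA] ->.
have /connectP[p] := connA _ _ rA xA.
elim/last_ind: p x xr xA => [|p y IHp] x xr xA.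
  by move=> _ xE; rewrite xE eqxx in xr.
rewrite rcons_path last_rcons => /andP[pth /and3P[lA yA adjy]] xE; subst y.
case: (eqVneq (last r p) r) adjy => [->|lr] adjy.
  by exists x; rewrite // !inE xr xA connect0.
have [z] := IHp _ lr lA pth erefl; rewrite !inE => /andP[zA lz rz].
exists z; rewrite // !inE zA /=; apply: connect_trans lz; apply: connect1.
by rewrite induced_adjE !inE xr xA lr lA adj_sym.
Qed.

(** The induction along the recursive definition. Connectedness of A is needed for
    the last condition: the subtree of a child c of r consists of a component of
    A without r, which must touch r. *)
Lemma search_tree_on_spec T A r :
  connected_in A -> search_tree_on T A r ->
  [/\ forall x, x \in A -> x \in subtree T r,
      forall x y, x \in A -> y \in A -> adj x y ->
        x \in subtree T y \/ y \in subtree T x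
    & forall x y, x \in A -> x != r -> T x = Some y ->
        exists2 z, z \in subtree T x & adj y z].
Proof.
have [n] := ubnP #|A|; elim: n A r => // n IHn A r cardA connA.
rewrite search_tree_onE => /andP[rA /forall_inP hC].
have sub C : C \in components (A :\ r) -> exists c,
  [/\ T c = Some r, forall x, x \in C -> x \in subtree T c,
      forall x y, x \in C -> y \in C -> adj x y ->
        x \in subtree T y \/ y \in subtree T x
    & forall x y, x \in C -> x != c -> T x = Some y ->
        exists2 z, z \in subtree T x & adj y z].
  move=> CA; have /exists_inP[c cC /andP[/eqP Tc Cc]] := hC _ CA.
  exists c; have [||h1 h2 h3] := IHn _ _ _ _ Cc.
  - move: cardA; rewrite (cardsD1 r A) rA ltnS; apply: leq_trans.
    by rewrite ltnS (subset_leq_card (component_sub CA)).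
  - exact: component_connected CA.
  - by split.
have below x : x \in A -> x \in subtree T r.
  move=> xA; case: (eqVneq x r) => [->|xr]; first exact: subtree_refl.
  have /mem_component[C CA xC] : x \in A :\ r by rewrite !inE xr.
  have [c [Tc Cc _ _]] := sub _ CA.
  by apply: subtree_trans (Cc _ xC) (subtree_parent Tc).
split=> // x y xA => [yA xy|xr Txy].
  case: (eqVneq x r) => [->|xr]; first by right; apply: below.
  case: (eqVneq y r) => [->|yr]; first by left; apply: below.
  have xAr : x \in A :\ r by rewrite !inE xr.
  have [c [_ _ cmp _]] := sub _ (imset_f _ xAr).
  apply: cmp => //; rewrite inE ?xAr ?connect0 // !inE yr yA /=.
  by apply: connect1; rewrite induced_adjE !inE xr yr xA yA.
have /mem_component[C CA xC] : x \in A :\ r by rewrite !inE xr.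
have [c [Tc Cc _ h]] := sub _ CA.
case: (eqVneq x c) => [xE|xc]; last exact: h xC xc Txy.
have [z zC rz] := component_adj connA rA CA.
by move: Txy; rewrite xE Tc => -[<-]; exists z; rewrite // Cc.
Qed.

Lemma is_search_tree_spec T : connected G -> is_search_tree T -> tree_spec T.
Proof.
move=> connG /existsP[r /andP[/eqP Tr hT]].
have [|below cmp nbr] := search_tree_on_spec _ hT.
  move=> x y _ _; apply: connect_sub (connG x y) => u w uw.
  by apply: connect1; rewrite induced_adjE !inE.
split=> [|x y|x y Txy]; [by exists r => // x; apply: below | exact: cmp |].
by apply: nbr (Txy) => //; apply/eqP => xr; rewrite xr Tr in Txy.
Qed.

Section FromSpec.

Variable T : {ffun G -> option G}.
Hypothesis specT : tree_spec T.

Let rootedT : rooted T. Proof. by case: specT. Qed.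

Lemma subtree_child_sub c w : T c = Some w -> subtree T c \subset subtree T w :\ w.
Proof.
move=> Tc; apply/subsetP => x xc; rewrite 2!inE.
rewrite (subtree_trans xc (subtree_parent Tc)) andbT.
by apply: contraTneq xc => ->; apply: parent_notin.
Qed.

Lemma card_subtree_child c w : T c = Some w -> (#|subtree T c| < #|subtree T w|)%N.
Proof.
move=> /subtree_child_sub/subset_leq_card h.
by rewrite [ltnRHS](cardsD1 w) subtree_refl ltnS.
Qed.

(** Each child subtree is connected by induction, and contains a neighbor of w. *)
Lemma subtree_connected w : connected_in (subtree T w).
Proof.
suff wD y : y \in subtree T w -> connect (induced_adj (subtree T w)) y w.
  by move=> y z /wD yD /wD zD; apply: connect_trans yD _; rewrite connect_inducedC.
have [n] := ubnP #|subtree T w|; elim: n w y => // n IHn w y cardw.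
case/subtree_down => [->//|[c Tc yc]].
have cw : subtree T c \subset subtree T w.
  exact: subset_trans (subtree_child_sub Tc) (subsetDl _ _).
have {}IHn z : z \in subtree T c -> connect (induced_adj (subtree T w)) z c.
  move=> zc; apply: (connect_inducedS cw); apply: IHn => //.
  by rewrite (leq_trans (card_subtree_child Tc)) // -ltnS.
have [_ _ /(_ _ _ Tc)[z zc wz]] := specT.
apply: connect_trans (IHn _ yc) _; rewrite connect_inducedC.
apply: connect_trans (IHn _ zc); apply: connect1.
by rewrite induced_adjE subtree_refl (subsetP cw) ?zc.
Qed.

(** A child subtree is connected, and no edge leaves it inside the subtree of w
    without w: the other end would be comparable with a vertex below c, hence with
    c itself, and everything strictly above c in that subtree is w. *)
Lemma components_subtree w C :
  C \in components (subtree T w :\ w) ->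
  exists2 c, T c = Some w & C = subtree T c.
Proof.
case/imsetP => x; rewrite 2!inE => /andP[xw xTw] CE.
case: (subtree_down xTw) => [xE|[c Tc xc]]; first by rewrite xE eqxx in xw.
exists c => //; rewrite CE; have cw := subtree_child_sub Tc.
apply/setP => y; rewrite inE; apply/andP/idP => [[_]|yc]; last first.
  rewrite (subsetP cw) //; split=> //; apply: (connect_inducedS cw).
  exact: subtree_connected.
case/connectP => p; elim/last_ind: p y => [|p y' IHp] y; first by move=> _ ->.
rewrite rcons_path last_rcons => /andP[pth /and3P[_ yA ly]] yE; subst y'.
have lc := IHp _ pth erefl.
have [_ /(_ _ _ ly)[l_y|y_l] _] := specT; last exact: subtree_trans y_l lc.
case: (subtree_total l_y lc) => // /subtree_up[<-|[z]]; first exact: subtree_refl.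
rewrite Tc => -[<-] wy; move: yA; rewrite 2!inE => /andP[yw yTw].
by case/eqP: yw; apply: (subtree_anti rootedT).
Qed.

Lemma search_tree_on_subtree w : search_tree_on T (subtree T w) w.
Proof.
have [n] := ubnP #|subtree T w|; elim: n w => // n IHn w cardw.
rewrite search_tree_onE subtree_refl; apply/forall_inP => C.
case/components_subtree => c Tc ->; apply/exists_inP.
exists c; rewrite ?subtree_refl // Tc eqxx IHn //.
by rewrite (leq_trans (card_subtree_child Tc)) // -ltnS.
Qed.

Lemma spec_is_search_tree : is_search_tree T.
Proof.
have [r Tr below] := rootedT; apply/existsP; exists r; rewrite Tr eqxx /=.
have <- : subtree T r = [set: G] by apply/setP => x; rewrite below inE.
exact: search_tree_on_subtree.
Qed.

End FromSpec.

Lemma is_search_treeP T : connected G -> is_search_tree T <-> tree_spec T.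
Proof.
by move=> connG; split; [apply: is_search_tree_spec | apply: spec_is_search_tree].
Qed.

End Characterization.

(** * Rotations and the descendant order *)

(** After the rotation, the parent of a vertex other than u was already
    strictly above it. So going up the rotated tree from x creates a new relation
    only when stepping from u to w, and the step that follows w leads to the old
    parent of u. *)
Lemma rotation_subtree (G : sgraph) (T : {ffun G -> option G}) u w x y :
  T w = Some u -> x \in subtree (rotation T u w) y ->
  x \in subtree T y \/ x \in subtree T u /\ y = w.
Proof.
move=> Tw; rewrite inE => /connectP[p].
elim/last_ind: p y => [|p y' IHp] y; first by move=> _ ->; left; apply: subtree_refl.
rewrite rcons_path last_rcons => /andP[pth /=]; rewrite ffunE => /[swap] ->.
have := IHp _ pth erefl; move: {pth} (last x p) => z.
case: (eqVneq z w) => [-> {z} xw /eqP Tu|zw].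
  left; apply: subtree_trans (subtree_parent Tu).
  by case: xw => [xw|[]//]; apply: subtree_trans xw (subtree_parent Tw).
case=> [xz|[_ zE]]; last by rewrite zE eqxx in zw.
case: (eqVneq z u) => [zu|zu]; first by move=> /eqP[<-]; right; rewrite -zu.
case: (eqVneq (T z) (Some w)) => [Tz|_ /eqP Tz]; last first.
  by left; apply: subtree_trans xz (subtree_parent Tz).
have xw := subtree_trans xz (subtree_parent Tz).
case: ifP => _ /eqP[<-]; left => //.
exact: subtree_trans xw (subtree_parent Tw).
Qed.

Lemma rotation_reverse (G : sgraph) (T : {ffun G -> option G}) u w a b :
  rooted T -> T w = Some u -> a != b -> b \in subtree T a ->
  a \in subtree (rotation T u w) b -> a = u /\ b = w.
Proof.
move=> rT Tw ab ba /(rotation_subtree Tw)[/(subtree_anti rT)/(_ ba)/eqP|[au bw]].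
  by rewrite (negbTE ab).
split=> //; subst b; case: (subtree_up ba) => [wa|[z]].
  by rewrite wa eqxx in ab.
by rewrite Tw => -[<-] ua; apply: (subtree_anti rT).
Qed.

(** * Relabelling by an involutive automorphism *)

Section Relabel.

Variables (H : sgraph) (f : H -> H).
Hypotheses (fK : involutive f) (f_adj : forall x y, adj (f x) (f y) = adj x y).
Implicit Type T : {ffun H -> option H}.

Definition relabel T : {ffun H -> option H} := [ffun x => omap f (T (f x))].

Lemma relabelK : involutive relabel.
Proof. by move=> T; apply/ffunP => x; rewrite !ffunE fK; case: (T x) => //= y; rewrite fK. Qed.

Lemma relabel_subtree T x y : (f x \in subtree (relabel T) (f y)) = (x \in subtree T y).
Proof.
have imp T' x' y' : x' \in subtree T' y' -> f x' \in subtree (relabel T') (f y').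
  elim/subtree_ind: x' / => [|x' z Txz _]; first exact: subtree_refl.
  by apply: subtree_trans; apply: subtree_parent; rewrite ffunE fK Txz.
by apply/idP/idP => /imp //; rewrite relabelK !fK.
Qed.

Lemma relabel_spec T : tree_spec T -> tree_spec (relabel T).
Proof.
case=> -[r Tr below] cmp nbr; split.
- exists (f r); first by rewrite ffunE fK Tr.
  by move=> x; rewrite -[x]fK relabel_subtree.
- by move=> x y; rewrite -[x]fK -[y]fK f_adj !relabel_subtree => /cmp.
move=> x y; rewrite ffunE; case Tx: (T (f x)) => [z|] //= [<-].
have [t tx zt] := nbr _ _ Tx; exists (f t); last by rewrite f_adj.
by rewrite -[x]fK relabel_subtree.
Qed.

End Relabel.

(** * True twins *)

Section Twins.

Variables (H : sgraph) (a b : H).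
Hypotheses (ab : a != b) (twin : true_twins a b).
Implicit Type T : {ffun H -> option H}.

Definition twin_swap (x : H) : H := if x == a then b else if x == b then a else x.

Lemma twin_swapL : twin_swap a = b. Proof. by rewrite /twin_swap eqxx. Qed.

Lemma twin_swapR : twin_swap b = a.
Proof. by rewrite /twin_swap eqxx eq_sym (negbTE ab). Qed.

Lemma twin_swapN x : x != a -> x != b -> twin_swap x = x.
Proof. by rewrite /twin_swap => /negbTE-> /negbTE->. Qed.

Lemma twin_swapK : involutive twin_swap.
Proof.
move=> x; case: (eqVneq x a) => [->|xa]; first by rewrite twin_swapL twin_swapR.
case: (eqVneq x b) => [->|xb]; first by rewrite twin_swapR twin_swapL.
by rewrite !twin_swapN.
Qed.

Lemma twin_nbr x : x != a -> x != b -> adj a x = adj b x.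
Proof.
by move=> /negbTE xa /negbTE xb; have /setP/(_ x) := twin; rewrite !inE xa xb.
Qed.

Lemma twin_adjLR : adj a b.
Proof.
by have /setP/(_ b) := twin; rewrite !inE eqxx eq_sym (negbTE ab).
Qed.

Lemma twin_swap_adj x y : adj (twin_swap x) (twin_swap y) = adj x y.
Proof.
have nbr z : z != a -> z != b -> forall t, adj z (twin_swap t) = adj z t.
  move=> za zb t; rewrite /twin_swap.
  case: eqVneq => [->|_]; first by rewrite adj_sym -twin_nbr // adj_sym.
  by case: eqVneq => // ->; rewrite adj_sym twin_nbr // adj_sym.
case: (boolP ((x == a) || (x == b))) => [xab|]; last first.
  by rewrite negb_or => /andP[xa xb]; rewrite (twin_swapN xa xb) nbr.
case: (boolP ((y == a) || (y == b))) => [yab|]; last first.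
  rewrite negb_or => /andP[ya yb]; rewrite (twin_swapN ya yb).
  by rewrite adj_sym nbr // adj_sym.
by case/orP: xab => /eqP->; case/orP: yab => /eqP->;
   rewrite ?twin_swapL ?twin_swapR ?adj_irr // adj_sym.
Qed.

(** Another child w of a would have below it a neighbor z of a, hence of b. Then b
    and z are comparable, although they lie below two different children of a. *)
Lemma twin_only_child T w :
  tree_spec T -> T b = Some a -> T w = Some a -> w = b.
Proof.
move=> [rT cmp nbr] Tb Tw; have [//|wb] := eqVneq w b.
have [z zw az] := nbr _ _ Tw.
have nbw : b \notin subtree T w.
  apply/negP => /subtree_up[bw|[c]]; first by rewrite bw eqxx in wb.
  by rewrite Tb => -[<-]; rewrite (negbTE (parent_notin rT Tw)).
have za : z != a by apply: contraTneq az => ->; rewrite adj_irr.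
have zb : z != b by apply: contraTneq zw => ->.
have nwb : w \notin subtree T b.
  apply/negP => /subtree_up[/eqP|[c]]; first by rewrite (negbTE wb).
  by rewrite Tw => -[<-]; rewrite (negbTE (parent_notin rT Tb)).
rewrite twin_nbr // in az; case: (cmp _ _ az) => [bz|zTb].
  by rewrite (subtree_trans bz zw) in nbw.
by case: (subtree_total zw zTb); [rewrite (negbTE nwb) | rewrite (negbTE nbw)].
Qed.

(** Nothing stays behind as a child of b: the subtree of any child of b
    contains a neighbor of b, which is a neighbor of its twin a, so the subtree
    moves to a. Since b was the only child of a, the result differs from T only
    in the names of a and b. *)
Lemma twin_rotation T :
  tree_spec T -> T b = Some a -> rotation T a b = relabel twin_swap T.
Proof.
move=> spT Tb; have [rT cmp nbr] := spT; apply/ffunP => x; rewrite !ffunE.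
case: (eqVneq x b) => [->|xb].
  rewrite twin_swapR; case Ta: (T a) => [y|] //=; rewrite twin_swapN //.
    by apply/eqP => ya; apply: (parent_neq rT (x := a)); rewrite Ta ya.
  apply/eqP => yb; have := parent_notin rT Tb.
  by rewrite subtree_parent // Ta yb.
case: (eqVneq x a) => [->|xa]; first by rewrite twin_swapL Tb /= twin_swapL.
rewrite twin_swapN //; case: eqP => [Tx|nTx]; last first.
  case Tx: (T x) => [y|] //=; rewrite twin_swapN //.
    by apply: contraNneq xb => ya; rewrite ya in Tx; rewrite (twin_only_child spT Tb Tx).
  by apply/eqP => yb; rewrite Tx yb in nTx.
rewrite Tx /= twin_swapR; case: ifP => // /negbT/negP[]; apply/exists_inP.
have [z zx bz] := nbr _ _ Tx; exists z; rewrite // twin_nbr //.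
  apply: contraTneq zx => ->; apply/negP => ax; have := parent_notin rT Tb.
  by rewrite (subtree_trans ax (subtree_parent Tx)).
by apply: contraTneq bz => ->; rewrite adj_irr.
Qed.

(** Reversing the order of the twins forces the rotation to be the one of the
    edge between them. *)
Lemma rotates_to_swap T T' :
  tree_spec T -> b \in subtree T a -> a \in subtree T' b -> rotates_to T T' ->
  T b = Some a /\ T' = relabel twin_swap T.
Proof.
move=> spT ba ab' /existsP[u /existsP[w /andP[/eqP Tw /eqP rot]]].
have rT : rooted T by case: spT.
rewrite rot in ab' *; have [au bw] := rotation_reverse rT Tw ab ba ab'.
by move: Tw; rewrite -au -bw => Tb; rewrite twin_rotation.
Qed.

End Twins.

Lemma twin_swapC (H : sgraph) (a b : H) : twin_swap a b =1 twin_swap b a.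
Proof.
move=> x; rewrite /twin_swap; case: (eqVneq x a) => [->|_].
  by case: eqVneq.
by case: eqVneq.
Qed.

(** * The cut separating the two orders of the twins *)

Section TwinSide.

Variables (H : sgraph) (a b : H).
Hypotheses (connH : connected H) (ab : a != b) (twin : true_twins a b).

Local Notation twin_swap := (twin_swap a b).
Local Notation twin_swapK := (twin_swapK ab).

Lemma swap_tree_subproof (T : search_tree H) :
  is_search_tree (relabel twin_swap (val T)).
Proof.
apply/is_search_treeP/(relabel_spec twin_swapK (twin_swap_adj ab twin)) => //.
exact/is_search_treeP/valP.
Qed.

Definition swap_tree (T : search_tree H) : search_tree H :=
  Sub (relabel twin_swap (val T)) (swap_tree_subproof T).

Lemma swap_treeK : involutive swap_tree.
Proof. by move=> T; apply: val_inj => /=; rewrite relabelK //; apply: twin_swapK. Qed.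

Definition twin_side : {set rotation_graph H} :=
  [set T : search_tree H | b \in subtree (val T) a].

Lemma in_twin_side (T : search_tree H) :
  (T \in twin_side) = (b \in subtree (val T) a).
Proof. by rewrite in_set. Qed.

Lemma in_swap_twin_side (T : search_tree H) :
  (swap_tree T \in twin_side) = (a \in subtree (val T) b).
Proof.
rewrite in_twin_side /= -[X in X \in _](twin_swapL a b).
by rewrite -[X in _ \in subtree _ X](twin_swapR ab) (relabel_subtree twin_swapK).
Qed.

Lemma swap_twin_side (T : search_tree H) :
  (swap_tree T \in twin_side) = (T \notin twin_side).
Proof.
rewrite in_swap_twin_side in_twin_side.
have [rT /(_ _ _ (twin_adjLR ab twin)) cmp _] := is_search_tree_spec connH (valP T).
apply/idP/idP => [aTb|nbTa]; last by case: cmp => // bTa; rewrite bTa in nbTa.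
by apply/negP => bTa; case/eqP: ab; apply: (subtree_anti rT).
Qed.

Lemma card_twin_side : (2 * #|twin_side| = #|rotation_graph H|)%N.
Proof.
have cardC : #|~: twin_side| = #|twin_side|.
  rewrite -(card_imset _ (inv_inj swap_treeK)); apply: eq_card => T.
  rewrite -{1}[T]swap_treeK mem_imset; last exact: inv_inj swap_treeK.
  by rewrite inE -swap_twin_side swap_treeK.
by rewrite mul2n -addnn -{2}cardC cardsC.
Qed.

(** Adjacency of trees is symmetrized, so the rotation may also go from T' to T;
    the same argument with the twins exchanged shows that it is again the swap,
    which is an involution. *)
Lemma crossing_swap (T T' : search_tree H) :
  T \in twin_side -> T' \notin twin_side -> rotation_adj T T' ->
  val T b = Some a /\ T' = swap_tree T.
Proof.
have spec (U : search_tree H) := is_search_tree_spec connH (valP U).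
rewrite -swap_twin_side in_swap_twin_side in_twin_side => bTa aT'b.
case/orP => [TT'|T'T].
  have [Tb T'E] := rotates_to_swap ab twin (spec T) bTa aT'b TT'.
  by split=> //; apply: val_inj.
have ba : b != a by rewrite eq_sym.
have [T'a TE] := rotates_to_swap ba (esym twin) (spec T') aT'b bTa T'T.
have {}TE : T = swap_tree T'.
  apply: val_inj; rewrite TE; apply/ffunP => x; rewrite !ffunE twin_swapC.
  by case: (val T' _) => //= y; rewrite twin_swapC.
by rewrite TE swap_treeK /= ffunE twin_swapR // T'a /= twin_swapR.
Qed.

Lemma card_boundary_twin_side :
  (#|edge_boundary twin_side| <= #|[set T : search_tree H | val T b == Some a]|)%N.
Proof.
set D := [set T | _].
apply: leq_trans (leq_imset_card (fun T => [set T; swap_tree T]) (mem D)).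
apply/subset_leq_card/subsetP => e /imset2P[T T' ST].
rewrite inE in_setC => /andP[nST' TT'] ->.
have [Tb ->] := crossing_swap ST nST' TT'.
by apply: imset_f; rewrite inE Tb.
Qed.

End TwinSide.

(** * Contracting the new twin *)

Section Contraction.

Variables (G : sgraph) (v : G).
Local Notation H := (add_true_twin v).
Implicit Type T : {ffun H -> option H}.

Lemma add_true_twin_connected : connected G -> connected H.
Proof.
move=> connG; have toV (x : H) : connect adj x (Some v : H).
  case: x => [x|]; last by apply: connect1; rewrite /adj /= inE eqxx.
  have /connectP[p] := connG x v; elim: p x => [|y p IHp] x /=; first by move=> _ ->.
  case/andP => xy pth lst; apply: connect_trans (IHp _ pth lst).
  exact: connect1.
move=> x y; apply: connect_trans (toV x) _.
by rewrite (sym_connect_sym (@adj_sym H)).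
Qed.

Definition merge_twin (x : H) : G := odflt v x.

Definition contract T : {ffun G -> option G} :=
  [ffun x => omap merge_twin (T (Some x))].

Lemma merge_twin_adj (x y : H) :
  adj x y -> [\/ adj (merge_twin x) (merge_twin y), x = Some v /\ y = None
                | x = None /\ y = Some v].
Proof.
case: x y => [x|] [y|] //=; rewrite /adj /= ?inE; first by constructor 1.
  by case: eqVneq => [->|_] /=; [constructor 2 | rewrite adj_sym; constructor 1].
by case: eqVneq => [->|_] /=; [constructor 3 | constructor 1].
Qed.

Lemma contract_subtree T (x y : H) :
  T None = Some (Some v) -> x \in subtree T y ->
  merge_twin x \in subtree (contract T) (merge_twin y).
Proof.
move=> Tv'; move: x; apply: subtree_ind => [|[x|] z Tx _]; first exact: subtree_refl.
  by apply: subtree_trans; apply: subtree_parent; rewrite ffunE Tx.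
by move: Tx; rewrite Tv' => -[<-].
Qed.

(** The only delicate point is the neighbor condition. The neighbor z of the
    parent of x may be merged with that parent, but only if z and the parent are
    the two twins; as v' is a child of v, this would put x below itself. *)
Lemma contract_spec T :
  tree_spec T -> T None = Some (Some v) -> tree_spec (contract T).
Proof.
move=> [rT cmp nbr] Tv'; have nv : (Some v : H) \notin subtree T None.
  exact: (parent_notin rT Tv').
have [r Tr below] := rT; split.
- case: r Tr below => [r|] Tr below; last by rewrite Tv' in Tr.
  exists r => [|x]; first by rewrite ffunE Tr.
  exact: (contract_subtree Tv' (below (Some x))).
- by move=> x y xy; case: (cmp (Some x) (Some y) xy) => /(contract_subtree Tv');
     [left | right].
move=> x y; rewrite ffunE; case Tx: (T (Some x)) => [y0|//] [<-].
have [z zx yz] := nbr _ _ Tx.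
exists (merge_twin z); first exact: (contract_subtree Tv' zx).
case: (merge_twin_adj yz) => // -[yE zE]; rewrite {}yE {}zE in zx Tx.
  case: (subtree_up zx) => [//|[c]]; rewrite Tv' => -[<-].
  by rewrite (negbTE (parent_notin rT Tx)).
by case/negP: nv; apply: subtree_trans zx (subtree_parent Tx).
Qed.

(** Contraction forgets only whether the parent of x is v or v', and it cannot be v,
    whose only child is v'. *)
Lemma contract_inj T T' :
  tree_spec T -> tree_spec T' ->
  T None = Some (Some v) -> T' None = Some (Some v) ->
  contract T = contract T' -> T = T'.
Proof.
have child (U : {ffun H -> option H}) (x : G) : tree_spec U -> U None = Some (Some v) ->
    U (Some x) <> Some (Some v).
  by move=> spU Uv' /(twin_only_child (add_true_twinP v) spU Uv').
move=> spT spT' Tv' Tv'' eqK; apply/ffunP => -[x|]; last by rewrite Tv' Tv''.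
have := child _ x spT Tv'; have := child _ x spT' Tv''.
have /ffunP/(_ x) := eqK; rewrite !ffunE.
case: (T (Some x)) (T' (Some x)) => [[y|]|] [[y'|]|] //= [] => [->|->|<-] //.
Qed.

Lemma card_twin_parent : connected G ->
  (#|[set T : search_tree H | val T None == Some (Some v)]| <= #|rotation_graph G|)%N.
Proof.
move=> connG; have connH := add_true_twin_connected connG.
set D := [set T | _]; have spec (T : search_tree H) := is_search_tree_spec connH (valP T).
rewrite -(card_in_imset (f := fun T : search_tree H => contract (val T)) (D := mem D)).
  rewrite [leqRHS]card_sig; apply: subset_leq_card; apply/subsetP => _ /imsetP[T TD ->].
  apply: spec_is_search_tree; apply: contract_spec (spec T) _.
  by apply/eqP; rewrite inE in TD.
move=> T T'; rewrite !inE => /eqP Tv /eqP Tv' /(contract_inj (spec T) (spec T') Tv Tv').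
exact: val_inj.
Qed.

End Contraction.

(** * The expansion bound *)

Theorem theorem3 (G : sgraph) (v : G) (connG : connected G) :
  edge_expansion (rotation_graph (add_true_twin v))
    <= (2 * #|rotation_graph G|%:R) / #|rotation_graph (add_true_twin v)|%:R.
Proof.
have connH := @add_true_twin_connected G v connG.
have vv' : (Some v : add_true_twin v) != None by [].
have twin := add_true_twinP v.
set S := twin_side (Some v : add_true_twin v) None.
have cardS : (2 * #|S| = _)%N := card_twin_side connH vv' twin.
have [S0|S0] := eqVneq S set0.
  (* Without search trees no set is admissible in the minimum, and the expansion
     is 0 by convention. *)
  rewrite /edge_expansion; case: pickP => [A|_]; last by rewrite !mulr_ge0 ?invr_ge0.
  by rewrite /expansion_set -cardS S0 cards0 leqn0 muln_eq0 cards_eq0 => /andP[/negbTE->].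
have expS : expansion_set S by rewrite /expansion_set S0 cardS leqnn.
apply: le_trans (edge_expansion_le expS) _.
rewrite -cardS natrM -mulf_div divff // mul1r ler_wpM2r ?invr_ge0 // ler_nat.
exact: leq_trans (card_boundary_twin_side connH vv' twin) (card_twin_parent _ connG).
Qed.
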